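(* There is an algorithm that, for every $d\ge 1$ and every finite set of vectors $V\subseteq\mathbb{R}^d$, finds an $\tilde O(d)$-spectral $d$-spanner $U\subseteq V$ of $V$ of size $|U|\le\tilde O(d)$, in time polynomial in $d$ and $|V|$. In particular there are universal constants $C,c>0$ such that every finite $V\subseteq\mathbb{R}^d$ has a subset $U\subseteq V$ with $|U|\le C d(1+\log d)^c$ such that for every $v\in V$ there is a probability distribution $\mu_v$ on $U$ with $vv^\intercal\preceq C d(1+\log d)^c\cdot\mathbb{E}_{u\sim\mu_v}[uu^\intercal]$.
   Context: $\preceq$ is the Loewner order on symmetric matrices. For $V\subseteq\mathbb{R}^d$, a subset $U\subseteq V$ is an $\alpha$-spectral $d$-spanner of $V$ if for every $v\in V$ there is a probability distribution $\mu_v$ on $U$ with $vv^\intercal\preceq\alpha\cdot\mathbb{E}_{u\sim\mu_v}[uu^\intercal]$, equivalently $\langle x,v\rangle^2\le\alpha\,\mathbb{E}_{u\sim\mu_v}\langle x,u\rangle^2$ for all $x\in\mathbb{R}^d$. The notation $\tilde O(f)$ hides logarithmic factors in $f$; i.e. $\tilde O(d)$ denotes a quantity at most $C d(1+\log d)^c$ for universal constants $C,c>0$. *)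

(* Defs.v *)
From HB Require Import structures.
From mathcomp Require Import all_boot all_order all_algebra.
From mathcomp Require Import finmap.
From mathcomp Require Import reals exp.

Set Implicit Arguments.
Unset Strict Implicit.
Unset Printing Implicit Defensive.

Import Order.TTheory GRing.Theory Num.Theory.

Local Open Scope fset_scope.
Local Open Scope ring_scope.

(* Spectral spanners *)

Definition loewner_le (R : realType) (d : nat) (A B : 'M[R]_d) : Prop :=
  [/\ A \is symmetricmx, B \is symmetricmx &
      forall x : 'cV[R]_d, 0 <= (x^T *m (B - A) *m x) 0 0].

(* The sum ranges over the elements of the finite set U, seen as a finType. *)
Definition is_distribution (R : realType) (T : choiceType) (U : {fset T})
    (mu : U -> R) : Prop :=
  (forall u : U, 0 <= mu u) /\ \sum_(u : U) mu u = 1.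

Definition second_moment (R : realType) (d : nat) (U : {fset 'cV[R]_d})
    (mu : U -> R) : 'M[R]_d :=
  \sum_(u : U) mu u *: (val u *m (val u)^T).

Definition spectral_spanner (R : realType) (d : nat) (alpha : R)
    (V U : {fset 'cV[R]_d}) : Prop :=
  U `<=` V /\
  forall v : 'cV[R]_d, v \in V ->
    exists2 mu : U -> R, is_distribution mu &
      loewner_le (v *m v^T) (alpha *: second_moment mu).

Definition soft_linear (R : realType) (C c : R) (d : nat) : R :=
  C * d%:R * (1 + ln d%:R) `^ c.

(* A real-number machine (real RAM, in the style of Blum-Shub-Smale): exact
   field operations and comparisons on reals at unit cost, plus a memory of
   natural numbers for indices and control.  Programs are finite syntax whose
   only constants are natural numbers.  Both memories consist of arrays,
   named by a literal, whose cells are addressed by two computed indices.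

   There is no rounding and no conversion between reals and naturals, and
   naturals are only added and subtracted, so that in t steps they grow by
   O(t) bits at most: unit cost is then the usual notion of time up to a polynomial. *)

Inductive nexp : Type :=
  | NConst of nat
  | NGet of nat & nexp & nexp
  | NAdd of nexp & nexp
  | NSub of nexp & nexp.

Inductive rexp : Type :=
  | RConst of nat
  | RGet of nat & nexp & nexp
  | RAdd of rexp & rexp
  | RSub of rexp & rexp
  | RMul of rexp & rexp
  | RDiv of rexp & rexp.

Inductive bexp : Type :=
  | BNLe of nexp & nexp
  | BRLe of rexp & rexp
  | BNot of bexp
  | BAnd of bexp & bexp.

Inductive cmd : Type :=
  | CSkip
  | CNSet of nat & nexp & nexp & nexp
  | CRSet of nat & nexp & nexp & rexp
  | CSeq of cmd & cmd
  | CIf of bexp & cmd & cmd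
  | CWhile of bexp & cmd.

Record state (R : realType) : Type := State {
  nmem : nat -> nat -> nat -> nat;
  rmem : nat -> nat -> nat -> R
}.

Definition upd (T : Type) (m : nat -> nat -> nat -> T) (a i j : nat) (x : T) :
    nat -> nat -> nat -> T :=
  fun a' i' j' => if [&& a' == a, i' == i & j' == j] then x else m a' i' j'.

Fixpoint neval (R : realType) (s : state R) (e : nexp) : nat :=
  match e with
  | NConst n => n
  | NGet a i j => nmem s a (neval s i) (neval s j)
  | NAdd e1 e2 => (neval s e1 + neval s e2)%N
  | NSub e1 e2 => (neval s e1 - neval s e2)%N
  end.

(* Division by zero returns 0; a program can test its divisors. *)
Fixpoint reval (R : realType) (s : state R) (e : rexp) : R :=
  match e with
  | RConst n => n%:R
  | RGet a i j => rmem s a (neval s i) (neval s j)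
  | RAdd e1 e2 => reval s e1 + reval s e2
  | RSub e1 e2 => reval s e1 - reval s e2
  | RMul e1 e2 => reval s e1 * reval s e2
  | RDiv e1 e2 => reval s e1 / reval s e2
  end.

Fixpoint beval (R : realType) (s : state R) (b : bexp) : bool :=
  match b with
  | BNLe e1 e2 => (neval s e1 <= neval s e2)%N
  | BRLe e1 e2 => reval s e1 <= reval s e2
  | BNot b1 => ~~ beval s b1
  | BAnd b1 b2 => beval s b1 && beval s b2
  end.

(* [exec p s t s'] : from state s, program p halts in state s' after t steps.
   Each assignment, and each evaluation of a guard, counts as one step; the
   expressions occurring in a program have bounded size, so counting their
   individual operations would change t by a constant factor only. *)
Inductive exec (R : realType) : cmd -> state R -> nat -> state R -> Prop :=
  | ExecSkip s : exec CSkip s 1 s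
  | ExecNSet s a i j e :
      exec (CNSet a i j e) s 1
        (State (upd (nmem s) a (neval s i) (neval s j) (neval s e)) (rmem s))
  | ExecRSet s a i j e :
      exec (CRSet a i j e) s 1
        (State (nmem s) (upd (rmem s) a (neval s i) (neval s j) (reval s e)))
  | ExecSeq p q s s1 s2 t1 t2 :
      exec p s t1 s1 -> exec q s1 t2 s2 -> exec (CSeq p q) s (t1 + t2)%N s2
  | ExecIfTrue b p q s s1 t1 :
      beval s b -> exec p s t1 s1 -> exec (CIf b p q) s t1.+1 s1
  | ExecIfFalse b p q s s1 t1 :
      ~~ beval s b -> exec q s t1 s1 -> exec (CIf b p q) s t1.+1 s1
  | ExecWhileTrue b p s s1 s2 t1 t2 :
      beval s b -> exec p s t1 s1 -> exec (CWhile b p) s1 t2 s2 ->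
      exec (CWhile b p) s (t1 + t2).+1 s2
  | ExecWhileFalse b p s :
      ~~ beval s b -> exec (CWhile b p) s 1 s.

(* Input: the list V = [:: v_0; ...; v_(n-1)] of vectors of R^d is presented by
   storing d and n in cells (0, 0) and (0, 1) of the natural array 0, and the
   j-th coordinate of v_i in cell (i, j) of the real array 0.  All other cells
   are 0. *)
Definition input (R : realType) (d : nat) (V : seq 'cV[R]_d) : state R :=
  State
    (upd (upd (fun _ _ _ => 0%N) 0 0 0 d) 0 0 1 (size V))
    (fun a i j =>
       if a == 0%N then oapp (fun k : 'I_d => (nth 0 V i) k 0) 0 (insub j)
       else 0).

(* Output: v_i is selected when cell (0, i) of the natural array 1 is
   nonzero. *)
Definition output (R : realType) (d : nat) (V : seq 'cV[R]_d) (s : state R) :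
    {fset 'cV[R]_d} :=
  [fset v in V | nmem s 1 0 (index v V) != 0%N].

(* Main.v *)
(* Gauss-Jordan elimination on the matrix whose rows are the vectors of V, with
   the largest entry of each column as pivot, expresses every vector in
   coordinates w where the pivot rows are unit vectors.  Starting from A = I,
   scan the vectors once and, whenever w^T A^-1 w > 1, select the vector and add
   w w^T to A.  At the end w w^T <= A for every vector: a skipped one has
   w^T A^-1 w <= 1 and A only grows, a selected one is a summand of A.  Since I
   is dominated by the sum over the pivots, v v^T is dominated by the sum over
   all d + k chosen vectors, that is, by (d + k) times their average.

   Each selection at least doubles det A, so 2^k <= det A.  Conversely, since
   the pivots are maximal, a unit triangular change of coordinates turns all
   the vectors and the identity into rows with entries in [-1, 1]; Hadamard's
   inequality then gives det A <= (d + k)^d, whence d + k = O(d log d). *)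

Require Import Defs.
From HB Require Import structures.
From mathcomp Require Import all_boot all_order all_algebra.
From mathcomp Require Import finmap.
From mathcomp Require Import reals exp.
From mathcomp Require Import ring lra zify.

Set Implicit Arguments.
Unset Strict Implicit.
Unset Printing Implicit Defensive.

Import Order.TTheory GRing.Theory Num.Theory.

Local Open Scope fset_scope.
Local Open Scope ring_scope.

(** * Determinants *)

(** Block elimination in the bordered matrix [M], once with the corner 1 as pivot and once with [A],
    computes [\det M] in two ways. *)
Lemma det_add_rank1 (F : fieldType) (d : nat) (A : 'M[F]_d) (u : 'cV_d)
    (w : 'rV_d) :
  A \in unitmx ->
  \det (A + u *m w) = \det A * (1 + (w *m invmx A *m u) 0 0).
Proof.
move=> uA.
pose M := block_mx (1%:M : 'M_1) (- w) u A.
have E1 : block_mx 1%:M 0 (- u) 1%:M *m M = block_mx 1%:M (- w) 0 (A + u *m w).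
  rewrite mulmx_block !mul0mx !mul1mx !mulmx1 !addr0 addNr.
  by rewrite mulmxN mulNmx opprK addrC.
have E2 : block_mx 1%:M (w *m invmx A) 0 1%:M *m M
    = block_mx (1%:M + w *m invmx A *m u) 0 u A.
  rewrite mulmx_block !mul0mx !mul1mx !add0r.
  by rewrite mulmxKV // addNr.
have := congr1 determinant E2; have := congr1 determinant E1.
rewrite !det_mulmx !det_lblock !det_ublock !det1 !mul1r => -> ->.
by rewrite det_mx11 !mxE mulrC.
Qed.

(** The Sherman-Morrison formula, checked by multiplying out. [g] is a separate parameter so that an
    entry of the kernel matrix can stand for it. *)
Lemma invmx_add_rank1 (F : fieldType) (d : nat) (A : 'M[F]_d) (u : 'cV_d)
    (w : 'rV_d) (g : F) :
  A \in unitmx -> g = (w *m invmx A *m u) 0 0 -> 1 + g != 0 ->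
  invmx (A + u *m w)
  = invmx A - (1 + g)^-1 *: (invmx A *m u *m (w *m invmx A)).
Proof.
move=> uA gE g1.
have wAu : w *m invmx A *m u = g%:M.
  by apply/matrixP=> i j; rewrite !ord1 gE !mxE mulr1n.
have uAuw : A + u *m w \in unitmx.
  by rewrite unitmxE det_add_rank1 // unitrM -unitmxE uA -gE unitfE.
suff E : (A + u *m w) *m (invmx A - (1 + g)^-1 *: (invmx A *m u *m (w *m invmx A)))
    = 1%:M by rewrite -[LHS]mulmx1 -E mulKmx.
rewrite mulmxBr mulmxDl mulmxV // -scalemxAr mulmxDl !mulmxA mulmxV // mul1mx.
rewrite -[u *m w *m invmx A *m u]mulmxA -[u *m w *m _]mulmxA.
rewrite [w *m (_ *m _)]mulmxA wAu mul_mx_scalar -!scalemxAl -mulmxA.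
rewrite -[X in X + g *: _]scale1r -scalerDl scalerA mulVf // scale1r.
by rewrite addrK.
Qed.

Lemma qform_delta (F : nzRingType) (d : nat) (M : 'M[F]_d) (i : 'I_d) :
  ((delta_mx i 0 : 'cV_d)^T *m M *m (delta_mx i 0 : 'cV_d)) 0 0 = M i i.
Proof. by rewrite trmx_delta -rowE -colE !mxE. Qed.

(* The induction splits off the first coordinate: the Schur complement of the
   corner entry is again positive definite, with a smaller diagonal. *)
Lemma hadamard_det_le (F : realFieldType) (d : nat) (M : 'M[F]_d) :
  M^T = M -> (forall x : 'cV_d, x != 0 -> 0 < (x^T *m M *m x) 0 0) ->
  \det M <= \prod_i M i i.
Proof.
elim: d M => [|d IH]; first by move=> M _ _; rewrite det_mx00 big_ord0.
rewrite -[d.+1]/(1 + d)%N => M MT pd; have diag_gt0 i : 0 < M i i.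
  rewrite -qform_delta; apply: pd; apply/eqP => /matrixP/(_ i 0)/eqP.
  by rewrite !mxE !eqxx oner_eq0.
have := diag_gt0 (lshift d 0); move: MT pd diag_gt0; rewrite -[M]submxK.
move: (ulsubmx M) (ursubmx M) (dlsubmx M) (drsubmx M) => a b b' C {M}.
rewrite tr_block_mx => /eq_block_mx [_ _ bT CT] pd _.
have {}bT : b' = b^T by rewrite -bT.
rewrite big_split_ord big_ord1 /= !block_mxEul; set al := a 0 0 => al_gt0.
have aE : a = al%:M by apply/matrixP=> i j; rewrite !ord1 !mxE mulr1n.
pose S := C - al^-1 *: (b^T *m b).
have ble : block_mx a b b' C
    = block_mx 1%:M 0 (al^-1 *: b^T) 1%:M *m block_mx al%:M b 0 S.
  rewrite mulmx_block !mul0mx !mul1mx !addr0 -aE.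
  rewrite aE mul_mx_scalar scalerA mulfV ?gt_eqF // scale1r -bT.
  by rewrite /S -scalemxAl -bT addrC subrK.
(* [z] completes [x] by the first coordinate that minimises the form; the minimum is the form of the
   Schur complement [S]. *)
have qS (x : 'cV_d) (z := col_mx (- al^-1 *: (b *m x)) x) :
    (x^T *m S *m x) 0 0 = (z^T *m block_mx a b b' C *m z) 0 0.
  have zL : z^T *m block_mx 1%:M 0 (al^-1 *: b^T) 1%:M = row_mx 0 x^T.
    rewrite tr_col_mx mul_row_block !mulmx1 mulmx0 add0r.
    by rewrite linearZ /= trmx_mul -scalemxAr scaleNr addNr.
  rewrite ble mulmxA zL mul_row_block !mul0mx mulmx0 !add0r.
  by rewrite mul_row_col mul0mx add0r.
have -> : \det (block_mx a b b' C) = al * \det S.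
  by rewrite ble det_mulmx det_lblock det_ublock !det1 !mul1r det_scalar1.
rewrite ler_pM2l //; apply: (le_trans (IH _ _ _)).
- by rewrite /S linearB linearZ /= trmx_mul trmxK CT.
- move=> x x0; rewrite qS; apply: pd; apply: contra_neq x0.
  by rewrite -col_mx0 => /eq_col_mx [].
apply: ler_prod => i _; rewrite block_mxEdr; apply/andP; split.
  rewrite -qform_delta qS; apply/ltW/pd/eqP.
  rewrite -col_mx0 => /eq_col_mx [_] /matrixP/(_ i 0)/eqP.
  by rewrite !mxE !eqxx oner_eq0.
rewrite !mxE big_ord1 !mxE lerBlDr lerDl -expr2.
by rewrite mulr_ge0 ?sqr_ge0 // invr_ge0 ltW.
Qed.

(** With r = (d + k) / (4d), taking logarithms gives (4r - 1) ln 2 <= ln 4 + ln d + ln r. The bounds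
    ln 2 >= 1/2, ln 4 <= 2 and ln r <= r - 1 turn this into r <= 3/2 + ln d, so that 4r <= 6 (1 + ln
    d). *)
Lemma arith_log_bound (R : realType) (d k : nat) : (0 < d)%N ->
  (2 ^+ k : R) <= (d + k)%:R ^+ d ->
  (d + k)%:R <= 6 * d%:R * (1 + ln d%:R) :> R.
Proof.
move=> d0 H.
have d1 : 1 <= d%:R :> R by rewrite ler1n.
have dpos : 0 < d%:R :> R by lra.
have m0 : 0 < (d + k)%:R :> R by rewrite ltr0n addn_gt0 d0.
have lnle (x : R) : 0 < x -> ln x <= x - 1.
  move=> x0; have -> : ln x = ln (1 + (x - 1)) by congr ln; ring.
  by apply: le_ln1Dx; lra.
have ln2 : 1 / 2 <= ln 2 :> R.
  have := lnle 2^-1; rewrite lnV ?posrE //; lra.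
have lnd : 0 <= ln d%:R :> R by apply: ln_ge0.
have ln4 : ln 4 <= 2 :> R.
  have -> : 4 = 2 ^+ 2 :> R by ring.
  by rewrite lnXn //; have := lnle 2; lra.
have : k%:R * ln 2 <= d%:R * ln (d + k)%:R :> R.
  by rewrite !mulr_natl -!lnXn // ler_ln // posrE exprn_gt0.
have -> : (d + k)%:R = 4 * d%:R * ((d + k)%:R / (4 * d%:R)) :> R.
  by field; rewrite pnatr_eq0 -lt0n.
set r := _ / _.
have r0 : 0 < r by rewrite divr_gt0 // mulr_gt0.
have kE : k%:R = 4 * d%:R * r - d%:R.
  by rewrite /r natrD; field; rewrite pnatr_eq0 -lt0n.
have -> : ln (4 * d%:R * r) = ln 4 + ln d%:R + ln r.
  have p4 : 0 < 4 :> R by [].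
  have p4d : 0 < 4 * d%:R :> R by rewrite mulr_gt0.
  by rewrite lnM // (lnM p4 dpos).
have k0 : 0 <= k%:R :> R by rewrite ler0n.
have k4 : k%:R = d%:R * (4 * r - 1) by rewrite kE; ring.
rewrite {1}k4 -[d%:R * _ * _]mulrA (ler_pM2l dpos) => Hr.
have r4 : 0 <= 4 * r - 1 by move: k0; rewrite k4 pmulr_rge0.
have := lnle r r0; have := ler_wpM2l r4 ln2 => ? ?.
have -> : 4 * d%:R * r = d%:R * (4 * r) by ring.
have -> : 6 * d%:R * (1 + ln d%:R) = d%:R * (6 * (1 + ln d%:R)) :> R by ring.
rewrite ler_pM2l //; lra.
Qed.

(** * Gauss-Jordan elimination *)

(** For a nonzero pivot these are column operations: column [j] is divided by the pivot, and
    multiples of it clear the rest of row [s], which becomes a unit vector. The rank-one form is the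
    one the machine executes. *)
Definition pivot_step (F : fieldType) (n d : nat) (s : 'I_n) (j : 'I_d)
    (W : 'M[F]_(n, d)) : 'M[F]_(n, d) :=
  \matrix_(i, q) (W i q - W i j / W s j * (W s q - (q == j)%:R)).

(** Such a [T] acts on the first [j] coordinates only. The bound on its entries controls the
    contribution of the identity matrix to the determinant estimate. *)
Definition unitri_below (F : realFieldType) (d j : nat) (T : 'M[F]_d) : Prop :=
  [/\ forall p q : 'I_d, `|T p q| <= 1, forall p : 'I_d, T p p = 1,
      forall p q : 'I_d, (p < q)%N -> T p q = 0 &
      forall p q : 'I_d, (j <= p)%N -> T p q = (p == q)%:R].

(* [T] undoes the clearing of the earlier columns: [W *m T] is the matrix that
   elimination without back-substitution would have produced. *)
Definition gj_inv (F : realFieldType) (n d : nat) (V W : 'M[F]_(n, d)) (j : nat)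
    (l : seq 'I_n) : Prop :=
  [/\ size l = j,
      exists Y : 'M_d, V = W *m Y,
      forall p : 'I_d, (p < j)%N ->
        (forall i, W i p = 0) \/
        (forall x0 q, W (nth x0 l p) q = (q == p)%:R) &
      exists2 T : 'M_d, unitri_below j T &
        forall i (q : 'I_d), (q < j)%N -> `|(W *m T) i q| <= 1].

Lemma gj_inv0 (F : realFieldType) (n d : nat) (V : 'M[F]_(n, d)) :
  gj_inv V V 0 [::].
Proof.
split=> //; first by exists 1%:M; rewrite mulmx1.
exists 1%:M => //; split=> [p q|p|p q pq|p q _]; rewrite !mxE ?eqxx //.
  by case: (p == q); rewrite ?normr1 ?normr0 // ler01.
by rewrite -val_eqE /= (ltn_eqF pq).
Qed.

Lemma unitri_belowW (F : realFieldType) (d j : nat) (T : 'M[F]_d) :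
  unitri_below j T -> unitri_below j.+1 T.
Proof. by case=> ? ? ? Td; split=> // p q /ltnW/Td. Qed.

Lemma mul_unitri_col (F : realFieldType) (n d : nat) (W : 'M[F]_(n, d))
    (j : 'I_d) (T : 'M[F]_d) (i : 'I_n) :
  unitri_below j.+1 T -> (W *m T) i j = W i j.
Proof.
case=> _ T1 T0 Td; rewrite !mxE (bigD1 j) //= T1 mulr1 big1 ?addr0 // => p pj.
case: (ltngtP p j) => pj'; first by rewrite T0 ?mulr0.
  by rewrite Td // (negPf pj) mulr0.
by rewrite (val_inj pj') eqxx in pj.
Qed.

(** If the pivot is zero, so is its column, and nothing changes: the index added to [l] is a
    placeholder. Otherwise row [j] of [T] receives the multipliers of the step, namely the first [j]
    entries of row [s] of [W *m T], which the invariant already bounds by 1. *)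
Lemma gj_inv_step (F : realFieldType) (n d : nat) (V W : 'M[F]_(n, d))
    (j : 'I_d) (l : seq 'I_n) (s : 'I_n) :
  gj_inv V W j l -> (forall i, `|W i j| <= `|W s j|) ->
  gj_inv V (pivot_step s j W) j.+1 (rcons l s).
Proof.
case=> sl [Y VE] unitW [T uT TW] smax.
have ltSE (p : 'I_d) : (p < j.+1)%N -> p = j \/ (p < j)%N.
  rewrite ltnS leq_eqVlt => /orP[/eqP pj|]; [left; exact: val_inj | by right].
have [Ws0|Ws0] := eqVneq (W s j) 0.
  have W0 i : W i j = 0.
    by apply/eqP; rewrite -normr_le0 -[X in _ <= X](normr0 F) -Ws0.
  have -> : pivot_step s j W = W.
    by apply/matrixP=> i q; rewrite mxE W0 !mul0r subr0.
  split; [by rewrite size_rcons sl | by exists Y | |].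
    move=> p /ltSE[->|pj]; first by left.
    case: (unitW p pj) => [|H]; first by left.
    by right=> x0 q; rewrite nth_rcons sl pj.
  exists T; first exact: unitri_belowW.
  move=> i q /ltSE[->|]; last exact: TW.
  by rewrite mul_unitri_col ?W0 ?normr0 ?ler01 //; apply: unitri_belowW.
pose r : 'rV_d := \row_q (W s q - (q == j)%:R).
pose x : 'cV_n := \col_i (W i j / W s j).
set W' := pivot_step s j W.
have W'E : W' = W - x *m r.
  by apply/matrixP=> i q; rewrite !mxE big_ord1 !mxE.
have W'j : col j W' = x.
  by apply/matrixP=> i q; rewrite !mxE eqxx mulrBr divfK // mulr1 opprB addrC subrK.
have mulW'j (u : 'rV_d) : W' *m (delta_mx j 0 *m u) = x *m u.
  by rewrite mulmxA -colE W'j.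
split; first by rewrite size_rcons sl.
(* Column [j] of the new matrix is [x], so adding it times [r] restores [W]. *)
- exists ((1%:M + delta_mx j 0 *m r) *m Y).
  by rewrite mulmxA mulmxDr mulmx1 mulW'j W'E subrK.
- move=> p /ltSE[->|pj].
    right=> x0 q; rewrite nth_rcons sl ltnn eqxx mxE divff // mul1r.
    by rewrite opprB addrC subrK.
  have pNj : p == j = false by rewrite -val_eqE /= ltn_eqF.
  case: (unitW p pj) => [H|H]; [left=> i | right=> x0 q].
    by rewrite mxE !H pNj subr0 mulr0 subr0.
  by rewrite nth_rcons sl pj mxE !H [j == p]eq_sym pNj !mul0r subr0.
pose r' : 'rV_d := \row_q (if (q < j)%N then (W *m T) s q else 0).
pose T' := T + delta_mx j 0 *m r'.
have T'E p q : T' p q = if (p == j) && (q < j)%N then (W *m T) s q else T p q.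
  rewrite mxE [(_ *m r') _ _]mxE big_ord1 mxE eqxx andbT mxE.
  case: eqP => [->|_]; rewrite ?mul0r ?addr0 // mul1r.
  case: ltnP => qj /=; last by rewrite addr0.
  case: uT => _ _ _ -> //; rewrite -val_eqE /= gtn_eqF // add0r.
  by [].
have uT' : unitri_below j.+1 T'.
  case: (uT) => T1 Tp T0 Td; split=> [p q|p|p q pq|p q pj]; rewrite T'E.
  - by case: ifP => // /andP[_ qj]; apply: TW.
  - by rewrite Tp; case: eqP => //= ->; rewrite ltnn.
  - rewrite T0 //; case: eqP => //= pj; rewrite ltnNge ltnW //.
    by rewrite -pj.
  - rewrite -val_eqE /= gtn_eqF //= Td //; exact: ltnW.
exists T' => // i q qj1.
have W'T' : W' *m T' = W *m T + x *m (r' - r *m T).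
  by rewrite [LHS]mulmxDr mulW'j W'E mulmxBl mulmxBr mulmxA -addrA [- _ + _]addrC.
(* In an earlier column the correction [r' - r *m T] vanishes: row [j] of [T] is zero there, so
   [r *m T] reduces to row [s] of [W *m T]. *)
case: (ltSE _ qj1) => [->|qj]; last first.
  have -> : (W' *m T') i q = (W *m T) i q; last exact: TW.
  rewrite W'T' mxE [(x *m _) i q]mxE big_ord1 [(r' - _) _ _]mxE [r' _ _]mxE qj.
  have -> : r *m T = row s W *m T - row j T.
    have -> : r = row s W - delta_mx 0 j.
      by apply/matrixP=> a b; rewrite !mxE ord1 eqxx.
    by rewrite mulmxBl -rowE.
  rewrite -row_mul !mxE.
  case: uT => _ _ _ -> //; rewrite -[j == q]val_eqE /= gtn_eqF //.
  by rewrite subr0 subrr mulr0 addr0.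
(* In column [j] the entries are quotients by the largest one. *)
rewrite mul_unitri_col //.
have -> : W' i j = x i 0 by rewrite -W'j [RHS]mxE.
by rewrite mxE normrM normfV ler_pdivrMr ?normr_gt0 // mul1r.
Qed.

(** * Greedy selection *)

Definition reg_moment (F : realFieldType) (n d : nat) (W : 'M[F]_(n, d))
    (l : seq 'I_n) : 'M[F]_d :=
  1%:M + \sum_(i <- l) (row i W)^T *m row i W.

Lemma reg_moment_cons (F : realFieldType) (n d : nat) (W : 'M[F]_(n, d))
    (l : seq 'I_n) (s : 'I_n) :
  reg_moment W (s :: l) = reg_moment W l + (row s W)^T *m row s W.
Proof. by rewrite /reg_moment big_cons addrCA addrC. Qed.

Lemma tr_reg_moment (F : realFieldType) (n d : nat) (W : 'M[F]_(n, d))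
    (l : seq 'I_n) : (reg_moment W l)^T = reg_moment W l.
Proof.
elim: l => [|s l IH]; first by rewrite /reg_moment big_nil addr0 trmx1.
by rewrite reg_moment_cons linearD /= IH trmx_mul trmxK.
Qed.

Lemma qform_rank1 (F : realFieldType) (n d : nat) (W : 'M[F]_(n, d)) (i : 'I_n)
    (y : 'cV[F]_d) :
  (y^T *m ((row i W)^T *m row i W) *m y) 0 0 = (W *m y) i 0 ^+ 2.
Proof.
rewrite mulmxA -mulmxA -trmx_mul -!row_mul mxE big_ord1 !mxE expr2.
by congr (_ * _); apply: eq_bigr => k _; rewrite !mxE.
Qed.

Lemma qform_reg_moment (F : realFieldType) (n d : nat) (W : 'M[F]_(n, d))
    (l : seq 'I_n) (y : 'cV[F]_d) :
  (y^T *m reg_moment W l *m y) 0 0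
  = \sum_p y p 0 ^+ 2 + \sum_(i <- l) (W *m y) i 0 ^+ 2.
Proof.
elim: l => [|s l IH].
  rewrite /reg_moment !big_nil !addr0 mulmx1 mxE.
  by apply: eq_bigr => p _; rewrite !mxE expr2.
rewrite reg_moment_cons mulmxDr mulmxDl mxE IH qform_rank1 big_cons.
by rewrite -addrA [X in _ + X]addrC.
Qed.

Lemma qform_reg_moment_ge0 (F : realFieldType) (n d : nat) (W : 'M[F]_(n, d))
    (l : seq 'I_n) (y : 'cV[F]_d) : 0 <= (y^T *m reg_moment W l *m y) 0 0.
Proof.
by rewrite qform_reg_moment addr_ge0 ?sumr_ge0 // => ? _; exact: sqr_ge0.
Qed.

(** Cauchy-Schwarz for the form Q of [A]: with z = A^-1 w^T and a = w y, its value at [y - a *: z]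
    is Q(y) - 2 a^2 + a^2 g, where g <= 1. *)
Lemma sqr_le_qform (F : realFieldType) (d : nat) (A : 'M[F]_d) (w : 'rV[F]_d)
    (y : 'cV[F]_d) :
  A \in unitmx -> A^T = A -> (forall x : 'cV_d, 0 <= (x^T *m A *m x) 0 0) ->
  (w *m invmx A *m w^T) 0 0 <= 1 ->
  (w *m y) 0 0 ^+ 2 <= (y^T *m A *m y) 0 0.
Proof.
move=> uA AT A0 g1.
pose z := invmx A *m w^T; pose a := (w *m y) 0 0.
have zA : z^T *m A = w.
  by rewrite trmx_mul trmxK trmx_inv AT mulmxKV.
have Az : A *m z = w^T by rewrite mulKVmx.
have aE : w *m y = a%:M by apply/matrixP=> i j; rewrite !ord1 [RHS]mxE mulr1n.
set g := (w *m invmx A *m w^T) 0 0 in g1.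
have zAz : z^T *m A *m z = g%:M.
  by apply/matrixP=> i j; rewrite zA !ord1 /g mulmxA [RHS]mxE mulr1n.
have := A0 (y - a *: z).
have zAy : z^T *m A *m y = a%:M by rewrite zA.
have yAz : y^T *m A *m z = a%:M.
  by rewrite -mulmxA Az -trmx_mul aE tr_scalar_mx.
have -> : (y - a *: z)^T = y^T - a *: z^T by rewrite linearB linearZ.
rewrite mulmxBr !mulmxBl -!scalemxAr.
rewrite -!scalemxAl zAy yAz zAz.
move: (y^T *m A *m y) => Q H; rewrite -/a.
have {H} : 0 <= Q 0 0 - 2 * a ^+ 2 + a ^+ 2 * g.
  by move: H; rewrite !mxE !mulr1n; congr (_ <= _); ring.
have : a ^+ 2 * g <= a ^+ 2 by rewrite ler_piMr ?sqr_ge0.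
clearbody a g; lra.
Qed.

(** [G] stands in for the inverse: its diagonal holds the quantities w^T A^-1 w to be tested, and
    each selection changes it by a rank-one matrix, so the machine never inverts a matrix. *)
Definition selection_inv (F : realFieldType) (n d : nat) (W : 'M[F]_(n, d))
    (k : nat) (G : 'M[F]_n) (l : seq 'I_n) : Prop :=
  [/\ G = W *m invmx (reg_moment W l) *m W^T,
      2 ^+ size l <= \det (reg_moment W l) &
      forall i : 'I_n, (i < k)%N -> forall y : 'cV_d,
        (W *m y) i 0 ^+ 2 <= (y^T *m reg_moment W l *m y) 0 0].

Lemma selection_inv0 (F : realFieldType) (n d : nat) (W : 'M[F]_(n, d)) :
  selection_inv W 0 (W *m W^T) [::].
Proof.
rewrite /selection_inv.
have -> : reg_moment W [::] = 1%:M by rewrite /reg_moment big_nil addr0.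
by split; rewrite ?det1 // invmx1 mulmx1.
Qed.

Lemma reg_moment_unit (F : realFieldType) (n d : nat) (W : 'M[F]_(n, d)) k G l :
  selection_inv W k G l -> reg_moment W l \in unitmx.
Proof.
case=> _ det_ge _; rewrite unitmxE unitfE gt_eqF //.
by apply: lt_le_trans det_ge; rewrite exprn_gt0.
Qed.

Lemma selection_kernelE (F : realFieldType) (n d : nat) (W : 'M[F]_(n, d)) k G l
    (i j : 'I_n) :
  selection_inv W k G l ->
  G i j = (row i W *m invmx (reg_moment W l) *m (row j W)^T) 0 0.
Proof.
by case=> -> _ _; rewrite tr_row colE mulmxA -!row_mul -colE !mxE.
Qed.

Lemma selection_skip (F : realFieldType) (n d : nat) (W : 'M[F]_(n, d))
    (s : 'I_n) G l :
  selection_inv W s G l -> G s s <= 1 -> selection_inv W s.+1 G l.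
Proof.
move=> inv Gs; have uA := reg_moment_unit inv.
rewrite (selection_kernelE _ _ inv) in Gs.
case: inv => GE det_ge cov; split=> // i; rewrite ltnS leq_eqVlt.
case/orP=> [/eqP/val_inj -> y|]; last exact: cov.
have -> : (W *m y) s 0 = (row s W *m y) 0 0 by rewrite -row_mul [RHS]mxE.
apply: sqr_le_qform => //; first exact: tr_reg_moment.
exact: qform_reg_moment_ge0.
Qed.

(** The Sherman-Morrison formula, multiplied by [W] and its transpose on the two sides, is the
    update of [G]. The determinant gains the factor [1 + G s s], which exceeds 2. *)
Lemma selection_add (F : realFieldType) (n d : nat) (W : 'M[F]_(n, d))
    (s : 'I_n) G l :
  selection_inv W s G l -> 1 < G s s ->
  selection_inv W s.+1 (\matrix_(i, j) (G i j - G i s / (1 + G s s) * G s j))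
    (s :: l).
Proof.
move=> inv Gs; have uA := reg_moment_unit inv.
have GE := selection_kernelE _ _ inv.
case: inv => G_eq det_ge cov.
have g1 : 1 + G s s != 0 by rewrite gt_eqF // addr_gt0 // (lt_trans _ Gs).
split.
- rewrite reg_moment_cons (invmx_add_rank1 uA (GE s s) g1).
  rewrite mulmxBr mulmxBl -G_eq; apply/matrixP=> i j.
  rewrite mxE [RHS]mxE; congr (_ + _).
  rewrite [RHS]mxE; congr (- _).
  rewrite -scalemxAr -scalemxAl [RHS]mxE mulrAC mulrC; congr (_ * _).
  have -> : W *m (invmx (reg_moment W l) *m (row s W)^T *m
      (row s W *m invmx (reg_moment W l))) *m W^T = col s G *m row s G.
    by rewrite tr_row colE !mulmxA -G_eq -colE -!mulmxA -!row_mul mulmxA -G_eq.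
  by rewrite mxE big_ord1 !mxE.
- rewrite reg_moment_cons det_add_rank1 // -GE /= exprSr.
  apply: ler_pM => //; first by rewrite exprn_ge0.
  lra.
- move=> i ilt y; rewrite reg_moment_cons mulmxDr mulmxDl [leRHS]mxE qform_rank1.
  move: ilt; rewrite ltnS leq_eqVlt => /orP[/eqP/val_inj ->|ilt].
    by rewrite lerDr qform_reg_moment_ge0.
  by apply: (le_trans (cov i ilt y)); rewrite lerDl sqr_ge0.
Qed.

(** On the diagonal of T^T A T the identity contributes the squared norm of a column of [T], at most
    d, and each selected vector one squared entry of [W *m T], at most 1. *)
Lemma selection_size (F : realFieldType) (n d : nat) (V W : 'M[F]_(n, d))
    k G (l l' : seq 'I_n) :
  gj_inv V W d l' -> selection_inv W k G l ->
  2 ^+ size l <= (d + size l)%:R ^+ d :> F.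
Proof.
case=> _ _ _ [T [Tle T1 T0 _] TW] [_ det_ge _]; apply: (le_trans det_ge).
have trT : \det T = 1.
  rewrite det_trig; last by apply/is_trig_mxP.
  by rewrite big1.
have -> : \det (reg_moment W l) = \det (T^T *m reg_moment W l *m T).
  by rewrite !det_mulmx det_tr trT mul1r mulr1.
apply: (@le_trans _ _ (\prod_(i < d) (d + size l)%:R)); last first.
  by rewrite prodr_const card_ord.
apply: (le_trans (hadamard_det_le _ _)).
- by rewrite !trmx_mul trmxK tr_reg_moment mulmxA.
- move=> x x0.
  have -> : x^T *m (T^T *m reg_moment W l *m T) *m x
      = (T *m x)^T *m reg_moment W l *m (T *m x).
    by rewrite trmx_mul !mulmxA.
  (* Strict positivity comes from the identity term, since [T] is invertible and [T *m x] therefore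
     nonzero. *)
  rewrite qform_reg_moment ltr_pwDl ?sumr_ge0 // => [|? _]; last exact: sqr_ge0.
  rewrite lt_neqAle sumr_ge0 => [|? _]; last exact: sqr_ge0.
  rewrite andbT; apply: contra_neq x0 => /esym/eqP.
  rewrite psumr_eq0 => [/allP H|? _]; last exact: sqr_ge0.
  have uT : T \in unitmx by rewrite unitmxE trT unitr1.
  rewrite -[x](mulKmx uT); suff -> : T *m x = 0 by rewrite mulmx0.
  apply/matrixP=> p q; rewrite ord1 [RHS]mxE; apply/eqP.
  by rewrite -sqrf_eq0; apply: (implyP (H p _)); rewrite ?mem_index_enum.
apply: ler_prod => q _; apply/andP; split.
  rewrite -qform_delta; set e := delta_mx q 0.
  have -> : e^T *m (T^T *m reg_moment W l *m T) *m e
      = (T *m e)^T *m reg_moment W l *m (T *m e) by rewrite trmx_mul !mulmxA.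
  exact: qform_reg_moment_ge0.
rewrite -qform_delta; set e := delta_mx q 0.
have -> : e^T *m (T^T *m reg_moment W l *m T) *m e
    = (T *m e)^T *m reg_moment W l *m (T *m e) by rewrite trmx_mul !mulmxA.
rewrite qform_reg_moment natrD lerD //.
  rewrite -[X in _ <= X%:R]card_ord -sumr_const ler_sum // => p _.
  by rewrite -colE mxE -real_normK ?num_real // expr_le1.
rewrite -sum1_size natr_sum ler_sum // => i _.
by rewrite mulmxA -colE mxE -real_normK ?num_real // expr_le1 // TW.
Qed.

(** The pivots pay for the identity term: a coordinate of [y] with a unit pivot row is the value of
    [W *m y] at that row. *)
Lemma spanner_cover (F : realFieldType) (n d : nat) (V W : 'M[F]_(n, d))
    G (l l' : seq 'I_n) (x : 'cV[F]_d) (i : 'I_n) :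
  gj_inv V W d l' -> selection_inv W n G l ->
  (V *m x) i 0 ^+ 2 <= \sum_(k <- l' ++ l) (V *m x) k 0 ^+ 2.
Proof.
case=> sl' [Y ->] unitW _ [_ _ cov].
(* A zero column of [W] has no unit pivot row; setting its coordinate to 0 leaves [W *m y] unchanged
   and removes its share of the norm. *)
pose y : 'cV_d := \col_p (if [forall k, W k p == 0] then 0 else (Y *m x) p 0).
have Wy : W *m Y *m x = W *m y.
  rewrite -mulmxA; apply/matrixP=> k q; rewrite ord1 !mxE; apply: eq_bigr => p _.
  rewrite [y _ _]mxE [(Y *m x) _ _]mxE; case: ifP => // /forallP/(_ k)/eqP ->.
  by rewrite !mul0r.
rewrite Wy; apply: (le_trans (cov i _ y)) => //.
rewrite qform_reg_moment big_cat lerD2r.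
rewrite (big_nth i) sl' big_mkord ler_sum // => p _.
have [W0|Wp] := unitW p (ltn_ord p).
  suff -> : y p 0 = 0 by rewrite expr0n sqr_ge0.
  by rewrite mxE; case: forallP => // -[] k; rewrite W0.
suff -> : (W *m y) (nth i l' p) 0 = y p 0 by [].
rewrite mxE (bigD1 p) //= Wp eqxx mul1r big1 ?addr0 // => q qp.
by rewrite Wp (negPf qp) mul0r.
Qed.

(** * Hoare rules for the real-number machine *)

Fixpoint nwrites (p : cmd) : seq nat :=
  match p with
  | CNSet a _ _ _ => [:: a]
  | CSeq p q | CIf _ p q => nwrites p ++ nwrites q
  | CWhile _ p => nwrites p
  | _ => [::]
  end.

Fixpoint rwrites (p : cmd) : seq nat :=
  match p with
  | CRSet a _ _ _ => [:: a]
  | CSeq p q | CIf _ p q => rwrites p ++ rwrites q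
  | CWhile _ p => rwrites p
  | _ => [::]
  end.

Definition agree (R : realType) (na ra : seq nat) (s s' : state R) : Prop :=
  (forall a, a \notin na -> forall i j, nmem s' a i j = nmem s a i j) /\
  (forall a, a \notin ra -> forall i j, rmem s' a i j = rmem s a i j).

Lemma agree_refl (R : realType) na ra (s : state R) : agree na ra s s.
Proof. by split. Qed.

Lemma agree_trans (R : realType) na ra (s s1 s2 : state R) :
  agree na ra s s1 -> agree na ra s1 s2 -> agree na ra s s2.
Proof.
by case=> n1 r1 [n2 r2]; split=> a Ha i j; [rewrite n2 ?n1 | rewrite r2 ?r1].
Qed.

Lemma agreeW (R : realType) na ra na' ra' (s s' : state R) :
  {subset na <= na'} -> {subset ra <= ra'} ->
  agree na ra s s' -> agree na' ra' s s'.
Proof.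
move=> sn sr [n1 r1]; split=> a Ha; [apply: n1 | apply: r1].
  by apply: contra Ha; apply: sn.
by apply: contra Ha; apply: sr.
Qed.

Lemma upd_neq (T : Type) (m : nat -> nat -> nat -> T) a i j x a' i' j' :
  a' != a -> upd m a i j x a' i' j' = m a' i' j'.
Proof. by rewrite /upd => /negPf ->. Qed.

Lemma exec_agree (R : realType) p (s s' : state R) t :
  exec p s t s' -> agree (nwrites p) (rwrites p) s s'.
Proof.
have sl (A B : seq nat) : {subset A <= A ++ B}.
  by move=> x; rewrite mem_cat => ->.
have sr (A B : seq nat) : {subset B <= A ++ B}.
  by move=> x; rewrite mem_cat orbC => ->.
elim=> {p s s' t} /=.
- by move=> s; apply: agree_refl.
- by move=> s a i j e; split=> //= b; rewrite inE => Hb i' j'; rewrite upd_neq.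
- by move=> s a i j e; split=> //= b; rewrite inE => Hb i' j'; rewrite upd_neq.
- move=> p q s s1 s2 _ _ _ H1 _ H2; apply: agree_trans.
    exact: (agreeW (sl _ _) (sl _ _) H1).
  exact: (agreeW (sr _ _) (sr _ _) H2).
- by move=> _ p q s s1 _ _ _; apply: agreeW.
- by move=> _ p q s s1 _ _ _; apply: agreeW.
- by move=> _ p s s1 s2 _ _ _ _ H1 _; apply: agree_trans.
- by move=> _ p s _; apply: agree_refl.
Qed.

(** Total correctness with an upper bound on time, so that branches and loop turns of different cost
    share one bound. *)
Definition runs (R : realType) (p : cmd) (s : state R) (T : nat)
    (Q : state R -> Prop) : Prop :=
  exists t s', [/\ exec p s t s', (t <= T)%N & Q s'].

(** The rule of consequence combined with the frame rule: the new postcondition may use that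
    unwritten arrays keep their contents. *)
Lemma runs_weaken (R : realType) p (s : state R) T T' (Q Q' : state R -> Prop) :
  runs p s T Q -> (T <= T')%N ->
  (forall s', agree (nwrites p) (rwrites p) s s' -> Q s' -> Q' s') ->
  runs p s T' Q'.
Proof.
case=> t [s' [ex tT Qs]] TT' QQ'; exists t, s'; split=> //.
  exact: leq_trans tT TT'.
by apply: QQ' => //; apply: exec_agree ex.
Qed.

Lemma runs_seq (R : realType) p q (s : state R) T1 T2 Q :
  runs p s T1 (fun s1 => agree (nwrites p) (rwrites p) s s1 -> runs q s1 T2 Q) ->
  runs (CSeq p q) s (T1 + T2) Q.
Proof.
case=> t1 [s1 [ex1 t1T /(_ (exec_agree ex1)) [t2 [s2 [ex2 t2T Qs]]]]].
exists (t1 + t2)%N, s2; split=> //; last exact: leq_add.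
exact: ExecSeq ex1 ex2.
Qed.

Lemma runs_skip (R : realType) (s : state R) (Q : state R -> Prop) :
  Q s -> runs CSkip s 1 Q.
Proof. by exists 1%N, s; split=> //; constructor. Qed.

Lemma runs_nset (R : realType) a i j e (s : state R) (Q : state R -> Prop) :
  Q (State (upd (nmem s) a (neval s i) (neval s j) (neval s e)) (rmem s)) ->
  runs (CNSet a i j e) s 1 Q.
Proof. by move=> ?; do 2!eexists; split; [constructor | |]. Qed.

Lemma runs_rset (R : realType) a i j e (s : state R) (Q : state R -> Prop) :
  Q (State (nmem s) (upd (rmem s) a (neval s i) (neval s j) (reval s e))) ->
  runs (CRSet a i j e) s 1 Q.
Proof. by move=> ?; do 2!eexists; split; [constructor | |]. Qed.

Lemma runs_if (R : realType) b p q (s : state R) T Q :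
  (if beval s b then runs p s T Q else runs q s T Q) ->
  runs (CIf b p q) s T.+1 Q.
Proof.
case: ifPn => Hb [t [s' [ex tT Qs]]]; exists t.+1, s'; split=> //.
  exact: ExecIfTrue.
exact: ExecIfFalse.
Qed.

Definition cfor (c : nat) (e : nexp) (p : cmd) : cmd :=
  CSeq (CNSet c (NConst 0) (NConst 0) (NConst 0))
    (CWhile (BNot (BNLe e (NGet c (NConst 0) (NConst 0))))
      (CSeq p (CNSet c (NConst 0) (NConst 0)
                 (NAdd (NGet c (NConst 0) (NConst 0)) (NConst 1))))).

Definition set_counter (R : realType) (s : state R) (c k : nat) : state R :=
  State (upd (nmem s) c 0 0 k) (rmem s).

(** The invariant must ignore the counter, because the increment comes after the body; the bound
    must survive the writes of the loop, because each guard evaluates it again. A turn costs a guard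
    and an increment beyond the body; the initial 2 is the initialisation and the last guard. *)
Lemma runs_for (R : realType) c e p (s : state R) n T (I : nat -> state R -> Prop) :
  c \notin nwrites p ->
  (forall s1, agree (c :: nwrites p) (rwrites p) s s1 -> neval s1 e = n) ->
  (forall k s1 m, I k s1 -> I k (set_counter s1 c m)) ->
  I 0%N s ->
  (forall k s1, (k < n)%N -> agree (c :: nwrites p) (rwrites p) s s1 -> I k s1 ->
     nmem s1 c 0 0 = k -> runs p s1 T (I k.+1)) ->
  runs (cfor c e p) s (2 + n * (T + 2)) (I n).
Proof.
move=> cp en Iset I0 step.
have agree_set s1 k : agree (c :: nwrites p) (rwrites p) s1 (set_counter s1 c k).
  by split=> //= a; rewrite inE negb_or => /andP[ac _] i j; rewrite upd_neq.
(* [m] is the number of turns left, on which the induction runs. *)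
have loop m k s1 : (k + m)%N = n -> agree (c :: nwrites p) (rwrites p) s s1 ->
    I k s1 -> nmem s1 c 0 0 = k ->
    runs (CWhile (BNot (BNLe e (NGet c (NConst 0) (NConst 0))))
      (CSeq p (CNSet c (NConst 0) (NConst 0)
                 (NAdd (NGet c (NConst 0) (NConst 0)) (NConst 1)))))
      s1 (m * (T + 2) + 1) (I n).
  elim: m k s1 => [|m IH] k s1 km ag Ik ck.
    exists 1%N, s1; split=> //; last by rewrite -km addn0.
    by apply: ExecWhileFalse; rewrite /= en // ck -km addn0 leqnn.
  have kn : (k < n)%N by rewrite -km addnS ltnS leq_addr.
  have [t [s2 [ex tT Ik2]]] := step k s1 kn ag Ik ck.
  have ag2 := exec_agree ex.
  have ck2 : nmem s2 c 0 0 = k by rewrite (proj1 ag2).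
  have [|||| t' [s3 [ex' tT' In]]] := IH k.+1 (set_counter s2 c k.+1).
  - by rewrite addSnnS.
  - apply: (agree_trans ag); apply: (@agree_trans _ _ _ _ s2); last exact: agree_set.
    by apply: agreeW ag2 => // a; rewrite inE orbC => ->.
  - exact: Iset.
  - by rewrite /= /upd !eqxx.
  exists ((t + 1) + t').+1, s3; split=> //; last by lia.
  apply: ExecWhileTrue ex'; first by rewrite /= en // ck -ltnNge.
  apply: ExecSeq ex _; rewrite /set_counter -[k.+1]addn1 -{1}ck2.
  by apply: (@ExecNSet _ s2 c (NConst 0) (NConst 0)
       (NAdd (NGet c (NConst 0) (NConst 0)) (NConst 1))).
have -> : (2 + n * (T + 2) = 1 + (n * (T + 2) + 1))%N by lia.
apply/runs_seq/runs_nset => _; apply: (loop n 0%N) => //.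
- exact: agree_set.
- exact: (Iset _ _ 0%N).
- by rewrite /= /upd !eqxx.
Qed.

Definition counter (a : nat) : nexp := NGet a (NConst 0) (NConst 0).

Definition mx_set (M : nat) (e1 e2 : nexp) (x : rexp) : cmd :=
  cfor 2 e1 (cfor 3 e2 (CRSet M (counter 2) (counter 3) x)).

(* Evaluating [x] for the cell (i, j) may use the cell (i, j) of [M] itself, but
   no other cell of [M]: the assignments then behave as simultaneous ones. *)
Lemma runs_mx_set (R : realType) M e1 e2 x (s : state R) n m
    (F : nat -> nat -> R) :
  (forall s1, agree [:: 2; 3]%N [:: M] s s1 -> neval s1 e1 = n /\ neval s1 e2 = m) ->
  (forall s1 i j, (i < n)%N -> (j < m)%N -> agree [:: 2; 3]%N [:: M] s s1 ->
     nmem s1 2 0 0 = i -> nmem s1 3 0 0 = j -> rmem s1 M i j = rmem s M i j ->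
     reval s1 x = F i j) ->
  runs (mx_set M e1 e2 x) s (2 + n * (2 + m * 3 + 2))
    (fun s' => forall i j, rmem s' M i j =
       if (i < n)%N && (j < m)%N then F i j else rmem s M i j).
Proof.
move=> en ex.
have sub233 : {subset [:: 2; 3; 3]%N <= [:: 2; 3]%N}.
  by move=> a; rewrite !inE; do !case: (_ == _).
have sub3 : {subset [:: 3]%N <= [:: 2; 3]%N}.
  by move=> a; rewrite !inE; do !case: (_ == _).
apply: (@runs_for _ _ _ _ _ _ _ (fun k s' => forall i j, rmem s' M i j =
       if (i < k)%N && (j < m)%N then F i j else rmem s M i j)) => //.
- by move=> s1 /(agreeW sub233 (fun _ => id)) ag; apply: (proj1 (en _ ag)).
- move=> i s1 ilt /(agreeW sub233 (fun _ => id)) ag Ii ci.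
  apply: (@runs_weaken _ _ _ (2 + m * (1 + 2)) _ (fun s' => forall i' j', rmem s' M i' j' =
       if (i' < i)%N && (j' < m)%N || (i' == i) && (j' < m)%N then F i' j'
       else rmem s M i' j')) => //; last first.
    move=> s' _ H i' j'; rewrite H -andb_orl orbC.
    by rewrite -leq_eqVlt.
  apply: (@runs_for _ _ _ _ _ _ _ (fun k s' => forall i' j', rmem s' M i' j' =
       if (i' < i)%N && (j' < m)%N || (i' == i) && (j' < k)%N then F i' j'
       else rmem s M i' j')) => //.
  + move=> s2 /(agreeW sub3 (fun _ => id)) ag2.
    by apply: (proj2 (en _ (agree_trans ag ag2))).
  + by move=> i' j'; rewrite Ii ltn0 andbF orbF.
  + move=> j s2 jlt /[dup] ag2 /(agreeW sub3 (fun _ => id)) ag3 Ij cj.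
    have {ag3} ag' := agree_trans ag ag3; apply: runs_rset => i' j' /=.
    have ci2 : nmem s2 2 0 0 = i by rewrite (proj1 ag2).
    rewrite ci2 cj /upd eqxx /= (ex s2 i j) //; last first.
      by rewrite Ij !ltnn eqxx.
    case: (i' =P i) => [->|/eqP/negPf ni] /=; last by rewrite Ij ni.
    rewrite ltnn /= ltnS leq_eqVlt; case: (j' =P j) => [->|_] //=.
    by rewrite Ij ltnn eqxx.
Qed.

(** * The program *)

Definition mx_of (R : realType) (s : state R) (a n m : nat) : 'M[R]_(n, m) :=
  \matrix_(i, j) rmem s a i j.

Definition has_dims (R : realType) (n d : nat) (s : state R) : Prop :=
  nmem s 0 0 0 = d /\ nmem s 0 0 1 = n.

Lemma agree_has_dims (R : realType) na ra (s s' : state R) n d :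
  0%N \notin na -> agree na ra s s' -> has_dims n d s -> has_dims n d s'.
Proof. by move=> na0 [nag _] [dE nE]; split; rewrite nag. Qed.

(* Real arrays: 0 holds the coordinates, reduced in place; 1 and 2 hold the
   column (in cells (i, 0)) and the row (in cells (0, j)) of a rank-one update;
   3 holds the kernel matrix w_i^T A^-1 w_j.  Natural arrays: 2, 3, 4 and 6 are
   loop counters, 5 is the current pivot row. *)
Definition dimE : nexp := NGet 0 (NConst 0) (NConst 0).
Definition sizeE : nexp := NGet 0 (NConst 0) (NConst 1).
Definition mark (i : nexp) : cmd := CNSet 1 (NConst 0) i (NConst 1).

(** Marks form a set, whereas [l] may repeat an index: a vector can be both a pivot and a greedy
    choice, and then counts twice in the bounds. *)
Definition marked (R : realType) (n : nat) (s : state R) (l : seq 'I_n) : Prop :=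
  forall i : 'I_n, (nmem s 1 0 i != 0%N) = (i \in l).

(** The factors are read from copies in arrays 1 and 2, since the update in place overwrites the row
    and column of [M] they come from. *)
Definition rank1_update (M : nat) (e1 e2 : nexp) : cmd :=
  mx_set M e1 e2 (RSub (RGet M (counter 2) (counter 3))
    (RMul (RGet 1 (counter 2) (NConst 0)) (RGet 2 (NConst 0) (counter 3)))).

Lemma runs_rank1_update (R : realType) M e1 e2 (s : state R) n m :
  (forall s1, agree [:: 2; 3]%N [:: M] s s1 -> neval s1 e1 = n /\ neval s1 e2 = m) ->
  1%N != M -> 2%N != M ->
  runs (rank1_update M e1 e2) s (2 + n * (2 + m * 3 + 2))
    (fun s' => mx_of s' M n m
       = \matrix_(i, j) (rmem s M i j - rmem s 1 i 0 * rmem s 2 0 j)).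
Proof.
move=> en M1 M2; apply: runs_weaken.
- apply: (@runs_mx_set _ _ _ _ _ _ n m
    (fun i j => rmem s M i j - rmem s 1 i 0 * rmem s 2 0 j)) => //.
  by move=> s1 i j ilt jlt [_ ag] /= -> -> ->; rewrite !ag // inE.
- by [].
- by move=> s' _ H; apply/matrixP=> i j; rewrite !mxE H !ltn_ord.
Qed.

(** Absolute values are compared through their squares. Row 0 is the first candidate, whence the
    number of rows [n.+1] in the specification. *)
Definition search_pivot : cmd :=
  CSeq (CNSet 5 (NConst 0) (NConst 0) (NConst 0))
   (cfor 6 sizeE
     (CIf (BRLe (RMul (RGet 0 (counter 5) (counter 4)) (RGet 0 (counter 5) (counter 4)))
                (RMul (RGet 0 (counter 6) (counter 4)) (RGet 0 (counter 6) (counter 4))))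
        (CNSet 5 (NConst 0) (NConst 0) (counter 6)) CSkip)).

Lemma runs_search_pivot (R : realType) (s : state R) n d (j : 'I_d) :
  has_dims n.+1 d s -> nmem s 4 0 0 = j ->
  runs search_pivot s (1 + (2 + n.+1 * (2 + 2)))
    (fun s' => exists2 k : 'I_n.+1, nmem s' 5 0 0 = k &
       forall i, `|mx_of s 0 n.+1 d i j| <= `|mx_of s 0 n.+1 d k j|).
Proof.
move=> dims cj; apply/runs_seq/runs_nset => /= ag0.
apply: runs_weaken.
- apply: (@runs_for _ _ _ _ _ n.+1 _ (fun k s' => exists2 k0 : 'I_n.+1,
    nmem s' 5 0 0 = k0 & forall i : 'I_n.+1, (i < k)%N ->
      `|mx_of s 0 n.+1 d i j| <= `|mx_of s 0 n.+1 d k0 j|)) => //.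
  + by move=> s1 /agree_has_dims H; case: (H n.+1 d).
  + by exists ord0.
  + move=> k s1 klt ag [k0 k0E k0max] ck; apply: runs_if.
    have W (i : nat) : rmem s1 0 i j = rmem s 0 i j by rewrite (proj2 ag).
    have c4 : nmem s1 4 0 0 = j by rewrite (proj1 ag).
    have kle (i : 'I_n.+1) : (i < k.+1)%N -> i = Ordinal klt \/ (i < k)%N.
      rewrite ltnS leq_eqVlt => /orP[/eqP ik|]; [left; exact: val_inj | by right].
    rewrite /= c4 k0E ck !W -!expr2 -[X in X <= _]real_normK ?num_real //.
    rewrite -[X in _ <= X]real_normK ?num_real // ler_sqr ?nnegrE ?normr_ge0 //.
    case: leP => Hk.
      apply: runs_nset => /=; exists (Ordinal klt); first exact: ck.
      move=> i /kle[->//|/k0max Hi]; apply: (le_trans Hi).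
      by rewrite !mxE.
    apply: runs_skip; exists k0 => // i /kle[->|]; last exact: k0max.
    by rewrite !mxE ltW.
- by [].
- by move=> s' _ [k kE kmax]; exists k => // i; apply: kmax.
Qed.

(* A zero pivot needs no special treatment: the column is then zero and, as
   division by zero returns 0, the step leaves the matrix unchanged. *)
Definition pivot_col : cmd :=
  CSeq search_pivot
 (CSeq (mark (counter 5))
 (CSeq (mx_set 1 sizeE (NConst 1)
          (RDiv (RGet 0 (counter 2) (counter 4)) (RGet 0 (counter 5) (counter 4))))
 (CSeq (mx_set 2 (NConst 1) dimE (RGet 0 (counter 5) (counter 3)))
 (CSeq (CRSet 2 (NConst 0) (counter 4)
          (RSub (RGet 2 (NConst 0) (counter 4)) (RConst 1)))
       (rank1_update 0 sizeE dimE))))).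

Definition pivot_col_time (n d : nat) : nat :=
  (1 + (2 + n * (2 + 2)) + (1 + ((2 + n * (2 + 1 * 3 + 2)) +
    ((2 + 1 * (2 + d * 3 + 2)) + (1 + (2 + n * (2 + d * 3 + 2)))))))%N.

Lemma runs_pivot_col (R : realType) (s : state R) n d (j : 'I_d) (l : seq 'I_n.+1) :
  has_dims n.+1 d s -> nmem s 4 0 0 = j -> marked s l ->
  runs pivot_col s (pivot_col_time n.+1 d)
    (fun s' => exists k : 'I_n.+1,
      [/\ forall i, `|mx_of s 0 n.+1 d i j| <= `|mx_of s 0 n.+1 d k j|,
          marked s' (rcons l k) &
          mx_of s' 0 n.+1 d = pivot_step k j (mx_of s 0 n.+1 d)]).
Proof.
move=> dims cj ml; apply: runs_seq.
apply: (runs_weaken (runs_search_pivot dims cj)) => // s1 _ [k ck kmax] ag1.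
apply/runs_seq/runs_nset => /=; rewrite ck; set s2 := State _ _ => ag2'.
have ag2 : agree [:: 5; 6; 1]%N [::] s s2.
  apply: (@agree_trans _ _ _ _ s1); [apply: agreeW ag1 | apply: agreeW ag2'] => //.
    by move=> a; rewrite !inE; do !case: (_ == _).
  by move=> a; rewrite !inE; do !case: (_ == _).
have c5 : nmem s2 5 0 0 = k by rewrite -ck.
have m2 : marked s2 (rcons l k).
  move=> i; rewrite mem_rcons inE -ml -val_eqE /= /upd !eqxx /=.
  by case: (nat_of_ord i == k); rewrite ?(proj1 ag1).
have dims2 : has_dims n.+1 d s2 by apply: agree_has_dims ag2 dims.
have c4 : nmem s2 4 0 0 = j by rewrite (proj1 ag2).
have W2 i q : rmem s2 0 i q = rmem s 0 i q by rewrite (proj2 ag2).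
move: {ag1 ag2' ck} s2 => s2 in ag2 c5 m2 dims2 c4 W2 *.
have en na ra s3 : 0%N \notin na -> agree na ra s2 s3 ->
    neval s3 sizeE = n.+1 /\ neval s3 dimE = d.
  by move=> na0 ag; case: (agree_has_dims na0 ag dims2).
apply/runs_seq/(@runs_weaken _ _ _ _ _ (fun s' => forall i q, rmem s' 1 i q =
  if (i < n.+1)%N && (q < 1)%N then rmem s 0 i j / rmem s 0 k j else rmem s2 1 i q)).
- apply: (@runs_mx_set _ _ _ _ _ _ n.+1 1 (fun i q => rmem s 0 i j / rmem s 0 k j)).
    by move=> s3 /en[].
  move=> s3 i q ilt qlt [nag rag] c2 _ _ /=.
  by rewrite c2 !nag // c4 c5 !rag // !W2.
- by [].
move=> s3 _ X3 ag3.
apply/runs_seq/(@runs_weaken _ _ _ _ _ (fun s' => forall i q, rmem s' 2 i q =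
  if (i < 1)%N && (q < d)%N then rmem s 0 k q else rmem s3 2 i q)).
- apply: (@runs_mx_set _ _ _ _ _ _ 1 d (fun i q => rmem s 0 k q)).
    move=> s4 ag4; have : agree [:: 2; 3; 3; 2; 2; 3]%N [:: 1; 2]%N s2 s4.
      apply: (agree_trans (agreeW _ _ ag3) (agreeW _ _ ag4)) => a;
        rewrite !inE; do !case: (_ == _) => //.
    by case/en.
  move=> s4 i q ilt qlt [nag rag] _ c3 _ /=.
  by rewrite c3 !nag // (proj1 ag3) // c5 !rag // (proj2 ag3) // W2.
- by [].
move=> s4 _ R4 ag4.
apply/runs_seq/runs_rset => /=.
rewrite (proj1 ag4) // (proj1 ag3) // c4; set s5 := State _ _ => _.
have W5 i q : rmem s5 0 i q = rmem s 0 i q.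
  by rewrite /= upd_neq // (proj2 ag4) // (proj2 ag3).
have X5 (i : 'I_n.+1) : rmem s5 1 i 0 = rmem s 0 i j / rmem s 0 k j.
  by rewrite /= upd_neq // (proj2 ag4) // X3 ltn_ord.
(* Subtracting 1 at column [j] has turned the copied pivot row into the row factor of
   [pivot_step]. *)
have R5 (q : 'I_d) : rmem s5 2 0 q = rmem s 0 k q - (q == j)%:R.
  rewrite /= /upd !R4 /= !ltn_ord -[q == j]val_eqE /=.
  by case: eqP => [->|_]; rewrite ?subr0.
have n5 a i q : a \notin [:: 2; 3]%N -> nmem s5 a i q = nmem s2 a i q.
  rewrite !inE negb_or => /andP[/negPf a2 /negPf a3].
  by rewrite /= (proj1 ag4) ?(proj1 ag3) // !inE a2 a3.
move: s5 W5 X5 R5 n5 => s5 W5 X5 R5 n5.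
apply: (@runs_weaken _ _ _ (2 + n.+1 * (2 + d * 3 + 2)) _ (fun s' => mx_of s' 0 n.+1 d
    = \matrix_(i, q) (rmem s5 0 i q - rmem s5 1 i 0 * rmem s5 2 0 q))) => //.
  apply: runs_rank1_update => // s6 [nag _].
  by rewrite /= !nag // !n5 //; case: dims2.
move=> s6 ag6 E; exists k; split=> //.
  by move=> i; rewrite (proj1 ag6) // n5 // m2.
by rewrite E; apply/matrixP=> i q; rewrite !mxE !W5 X5 R5.
Qed.

(** This is the kernel matrix for A = I. With the coordinate loop outermost, it is accumulated as a
    sum of rank-one matrices, each added entrywise by [mx_set], starting from a zero array 3. *)
Definition gram : cmd :=
  cfor 4 dimE (mx_set 3 sizeE sizeE
    (RAdd (RGet 3 (counter 2) (counter 3))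
       (RMul (RGet 0 (counter 2) (counter 4)) (RGet 0 (counter 3) (counter 4))))).

Lemma runs_gram (R : realType) (s : state R) n d :
  has_dims n d s -> (forall i j, rmem s 3 i j = 0) ->
  runs gram s (2 + d * (2 + n * (2 + n * 3 + 2) + 2))
    (fun s' => mx_of s' 3 n n = mx_of s 0 n d *m (mx_of s 0 n d)^T).
Proof.
move=> dims G0.
apply: (@runs_weaken _ _ _ (2 + d * (2 + n * (2 + n * 3 + 2) + 2)) _
  (fun s' => forall i j, (i < n)%N -> (j < n)%N ->
     rmem s' 3 i j = \sum_(p < d) rmem s 0 i p * rmem s 0 j p)) => //; last first.
  move=> s' _ H; apply/matrixP=> i j; rewrite !mxE H //.
  by apply: eq_bigr => p _; rewrite !mxE.
apply: (@runs_for _ _ _ _ _ _ _ (fun k s' => forall i j, (i < n)%N -> (j < n)%N ->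
     rmem s' 3 i j = \sum_(p < k) rmem s 0 i p * rmem s 0 j p)) => //.
- by move=> s1 /agree_has_dims H; case: (H n d).
- by move=> i j _ _; rewrite big_ord0.
- move=> k s1 klt ag Ik ck.
  apply: (@runs_weaken _ _ _ (2 + n * (2 + n * 3 + 2)) _
    (fun s' => forall i j, rmem s' 3 i j = if (i < n)%N && (j < n)%N then
       rmem s1 3 i j + rmem s 0 i k * rmem s 0 j k else rmem s1 3 i j)) => //.
    apply: (@runs_mx_set _ _ _ _ _ _ n n
      (fun i j => rmem s1 3 i j + rmem s 0 i k * rmem s 0 j k)).
      move=> s2 ag2; have {ag2} : agree [:: 2; 3; 4]%N [:: 3]%N s s2.
        apply: (agree_trans (agreeW _ _ ag) (agreeW _ _ ag2)) => a;
          by rewrite !inE; do !case: (_ == _).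
      by move=> /agree_has_dims H; case: (H n d).
    move=> s2 i j ilt jlt [nag rag] /= -> -> ->.
    by rewrite !rag // nag // ck ![rmem s1 0 _ _](proj2 ag).
  move=> s2 _ H i j ilt jlt; rewrite H ilt jlt /= Ik //.
  by rewrite big_ord_recr.
Qed.

Definition select_row : cmd :=
  CIf (BNot (BRLe (RGet 3 (counter 4) (counter 4)) (RConst 1)))
   (CSeq (mark (counter 4))
   (CSeq (mx_set 1 sizeE (NConst 1)
            (RDiv (RGet 3 (counter 2) (counter 4))
                  (RAdd (RConst 1) (RGet 3 (counter 4) (counter 4)))))
   (CSeq (mx_set 2 (NConst 1) sizeE (RGet 3 (counter 4) (counter 3)))
         (rank1_update 3 sizeE sizeE))))
   CSkip.

Definition select_row_time (n : nat) : nat :=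
  (1 + ((2 + n * (2 + 1 * 3 + 2)) +
    ((2 + 1 * (2 + n * 3 + 2)) + (2 + n * (2 + n * 3 + 2))))).+1%N.

(** [l0] carries the pivots, whose marks share an array with the greedy choices. *)
Lemma runs_select_row (R : realType) (s : state R) n d (k : 'I_n)
    (W : 'M[R]_(n, d)) (l0 l : seq 'I_n) :
  has_dims n d s -> nmem s 4 0 0 = k -> marked s (l0 ++ l) ->
  selection_inv W k (mx_of s 3 n n) l ->
  runs select_row s (select_row_time n)
    (fun s' => exists2 l', marked s' (l0 ++ l') &
       selection_inv W k.+1 (mx_of s' 3 n n) l').
Proof.
move=> dims ck ml inv; apply: runs_if; rewrite /= ck.
have GkE : rmem s 3 k k = mx_of s 3 n n k k by rewrite mxE.
case: leP => Gk /=.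
  exists 1%N, s; split; [exact: ExecSkip | by [] | exists l => //].
  by apply: selection_skip; rewrite // -GkE.
apply/runs_seq/runs_nset => /=; rewrite ck; set s2 := State _ _ => ag2.
have m2 : marked s2 (l0 ++ k :: l).
  move=> i; rewrite mem_cat inE orbCA -mem_cat -ml -val_eqE /= /upd !eqxx /=.
  by case: (nat_of_ord i == k).
have c4 : nmem s2 4 0 0 = k by [].
have G2 i q : rmem s2 3 i q = rmem s 3 i q by [].
have en na ra s3 : 0%N \notin na -> agree na ra s2 s3 -> neval s3 sizeE = n.
  by move=> na0 ag; case: (agree_has_dims na0 ag dims).
move: s2 ag2 m2 c4 G2 en => s2 _ m2 c4 G2 en.
apply/runs_seq/(@runs_weaken _ _ _ _ _ (fun s' => forall i q, rmem s' 1 i q =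
  if (i < n)%N && (q < 1)%N then rmem s 3 i k / (1 + rmem s 3 k k)
  else rmem s2 1 i q)).
- apply: (@runs_mx_set _ _ _ _ _ _ n 1
    (fun i q => rmem s 3 i k / (1 + rmem s 3 k k))).
    by move=> s3 /en ->.
  move=> s3 i q ilt qlt [nag rag] c2 _ _ /=.
  by rewrite c2 !nag // c4 !rag // !G2.
- by [].
move=> s3 _ X3 ag3.
have en3 s4 : agree [:: 2; 3]%N [:: 2]%N s3 s4 -> neval s4 sizeE = n.
  move=> ag4; have : agree [:: 2; 3; 3; 2; 2; 3]%N [:: 1; 2]%N s2 s4.
    apply: (agree_trans (agreeW _ _ ag3) (agreeW _ _ ag4)) => a;
      rewrite !inE; do !case: (_ == _) => //.
  exact: en.
apply/runs_seq/(@runs_weaken _ _ _ _ _ (fun s' => forall i q, rmem s' 2 i q =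
  if (i < 1)%N && (q < n)%N then rmem s 3 k q else rmem s3 2 i q)).
- apply: (@runs_mx_set _ _ _ _ _ _ 1 n (fun i q => rmem s 3 k q)).
    by move=> s4 /en3 ->.
  move=> s4 i q ilt qlt [nag rag] _ c3 _ /=.
  by rewrite c3 !nag // (proj1 ag3) // c4 !rag // (proj2 ag3) // G2.
- by [].
move=> s4 _ R4 ag4.
have n4 a i q : a \notin [:: 2; 3]%N -> nmem s4 a i q = nmem s2 a i q.
  rewrite !inE negb_or => /andP[/negPf a2 /negPf a3].
  by rewrite (proj1 ag4) ?(proj1 ag3) // !inE a2 a3.
apply: (@runs_weaken _ _ _ (2 + n * (2 + n * 3 + 2)) _ (fun s' => mx_of s' 3 n n
    = \matrix_(i, q) (rmem s4 3 i q - rmem s4 1 i 0 * rmem s4 2 0 q))) => //.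
  apply: runs_rank1_update => // s6 [nag _].
  rewrite /= !nag // !n4 //.
  by split; exact: (en [::] [::] s2 isT (agree_refl _ _ _)).
move=> s6 ag6 E; exists (k :: l).
  by move=> i; rewrite (proj1 ag6) // n4 // m2.
suff -> : mx_of s6 3 n n = \matrix_(i, j) (mx_of s 3 n n i j
    - mx_of s 3 n n i k / (1 + mx_of s 3 n n k k) * mx_of s 3 n n k j).
  by apply: selection_add; rewrite // -GkE.
rewrite E; apply/matrixP=> i q; rewrite !mxE R4 !ltn_ord /=.
by rewrite (proj2 ag4) // (proj2 ag3) // G2 (proj2 ag4) // X3 !ltn_ord.
Qed.

(** * Spectral spanners from covering lists of vectors *)

Lemma sum_count_fset (R : realType) (T : choiceType) (U : {fset T}) (l : seq T)
    (F : T -> R) :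
  {subset l <= U} ->
  \sum_(u : U) (count_mem (val u) l)%:R * F (val u) = \sum_(v <- l) F v.
Proof.
elim: l => [|v l IH] lU; first by rewrite big_nil big1 // => u _; rewrite mul0r.
have vU : v \in U by apply: lU; rewrite mem_head.
rewrite big_cons -IH => [|u ul]; last by apply: lU; rewrite inE ul orbT.
under eq_bigr => u _ do rewrite /= natrD mulrDl.
rewrite big_split /=; congr (_ + _).
rewrite (bigD1 [` vU]) //= eqxx mul1r big1 ?addr0 // => u uv.
rewrite (_ : (v == val u) = false) ?mul0r //; apply: contra_neqF uv => /eqP vu.
exact: val_inj.
Qed.

Lemma outer_symmetric (R : realType) (d : nat) (v : 'cV[R]_d) :
  v *m v^T \is symmetricmx.
Proof.
by apply/is_hermitianmxP; rewrite expr0 scale1r map_mx_id // trmx_mul trmxK.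
Qed.

Lemma qform_outer (R : realType) (d : nat) (x u : 'cV[R]_d) :
  (x^T *m (u *m u^T) *m x) 0 0 = (u^T *m x) 0 0 ^+ 2.
Proof.
rewrite mulmxA -mulmxA mxE big_ord1 expr2; congr (_ * _).
by rewrite -[x^T *m u]trmxK trmx_mul trmxK mxE.
Qed.

(** The empirical distribution of [l], multiplicity over length, serves every [v]; the factor
    [alpha] compensates for the division by the length. *)
Lemma spanner_of_cover (R : realType) (d : nat) (alpha : R)
    (V U : {fset 'cV[R]_d}) (l : seq 'cV[R]_d) :
  U `<=` V -> {subset l <= U} -> (0 < size l)%N -> (size l)%:R <= alpha ->
  (forall v x : 'cV[R]_d, v \in V ->
     (v^T *m x) 0 0 ^+ 2 <= \sum_(u <- l) (u^T *m x) 0 0 ^+ 2) ->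
  spectral_spanner alpha V U.
Proof.
move=> UV lU l0 la cov; split=> // v vV.
have sz0 : 0 < (size l)%:R :> R by rewrite ltr0n.
exists (fun u : U => (count_mem (val u) l)%:R / (size l)%:R).
  split=> [u|]; first by rewrite divr_ge0 ?ler0n.
  rewrite -mulr_suml.
  rewrite (eq_bigr (fun u : U => (count_mem (val u) l)%:R * 1)) => [|u _];
    last by rewrite mulr1.
  rewrite (sum_count_fset (fun=> 1) lU) big_const_seq count_predT iter_addr addr0.
  by rewrite divff // gt_eqF.
split; first exact: outer_symmetric.
  apply/is_hermitianmxP; rewrite expr0 scale1r map_mx_id // linearZ /=.
  congr (_ *: _); rewrite /second_moment linear_sum; apply: eq_bigr => u _.
  by rewrite linearZ /= trmx_mul trmxK.
move=> x; rewrite mulmxBr mulmxBl mxE [X in _ + X]mxE qform_outer subr_ge0.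
apply: (le_trans (cov v x vV)).
have -> : (x^T *m (alpha *: second_moment
      (fun u : U => (count_mem (val u) l)%:R / (size l)%:R)) *m x) 0 0
    = alpha / (size l)%:R * \sum_(u <- l) (u^T *m x) 0 0 ^+ 2.
  rewrite -scalemxAr -scalemxAl mxE -mulrA; congr (_ * _).
  rewrite -(sum_count_fset _ lU) mulr_sumr /second_moment mulmx_sumr mulmx_suml.
  rewrite summxE; apply: eq_bigr => u _.
  by rewrite -scalemxAr -scalemxAl mxE qform_outer mulrA [_^-1 * _]mulrC.
rewrite ler_peMl //; last by rewrite ler_pdivlMr // mul1r.
by rewrite sumr_ge0 // => u _; apply: sqr_ge0.
Qed.

(** * The whole program: running time and correctness *)

Definition spanner_prog : cmd :=
  CIf (BNLe sizeE (NConst 0)) CSkip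
    (CSeq (cfor 4 dimE pivot_col) (CSeq gram (cfor 4 sizeE select_row))).

Definition spanner_prog_time (n d : nat) : nat :=
  ((2 + d * (pivot_col_time n d + 2)) +
   ((2 + d * (2 + n * (2 + n * 3 + 2) + 2)) +
    (2 + n * (select_row_time n + 2)))).+1%N.

Lemma spanner_prog_time_poly (n d : nat) :
  (0 < d)%N -> (spanner_prog_time n d <= 100 * (d + n) ^ 100)%N.
Proof.
move=> d0; pose N := (d + n)%N.
have nN : (n <= N)%N by rewrite leq_addl.
have dN : (d <= N)%N by rewrite leq_addr.
have N0 : (0 < N)%N by rewrite addn_gt0 d0.
have N1 : (N <= N * N)%N by rewrite leq_pmulr.
have nn := leq_mul nN nN; have nd := leq_mul nN dN.
have tp : (pivot_col_time n d <= 36 * (N * N))%N by rewrite /pivot_col_time; nia.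
have ts : (select_row_time n <= 36 * (N * N))%N by rewrite /select_row_time; nia.
have tg : (2 + n * (2 + n * 3 + 2) <= 9 * (N * N))%N by nia.
(* The time is cubic in [N]; the exponent becomes 100 because a single [K] is both factor and
   exponent in the theorem. *)
apply: (@leq_trans (100 * (N * (N * N)))); last first.
  by rewrite leq_mul2l /= -[N in (N * _)%N]expn1 mulnn -expnD leq_pexp2l.
have N2 : (N <= N * (N * N))%N by rewrite leq_pmulr // muln_gt0 N0.
have h1 : (d * (pivot_col_time n d + 2) <= N * (38 * (N * N)))%N.
  by apply: leq_mul => //; lia.
have h2 : (d * (2 + n * (2 + n * 3 + 2) + 2) <= N * (11 * (N * N)))%N.
  by apply: leq_mul => //; lia.
have h3 : (n * (select_row_time n + 2) <= N * (38 * (N * N)))%N.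
  by apply: leq_mul => //; lia.
rewrite /spanner_prog_time; lia.
Qed.

Lemma runs_spanner_prog (R : realType) (s : state R) n d :
  has_dims n.+1 d s -> (forall i j, nmem s 1 i j = 0%N) ->
  (forall i j, rmem s 3 i j = 0) ->
  runs spanner_prog s (spanner_prog_time n.+1 d)
    (fun s' => exists W G l l',
      [/\ gj_inv (mx_of s 0 n.+1 d) W d l', selection_inv W n.+1 G l &
          marked s' (l' ++ l)]).
Proof.
move=> dims m0 G0; apply: runs_if; rewrite /= (proj2 dims) /=.
apply/runs_seq/(@runs_weaken _ _ _ _ _ (fun s' => exists2 l',
   gj_inv (mx_of s 0 n.+1 d) (mx_of s' 0 n.+1 d) d l' & marked s' l')).
- apply: (@runs_for _ _ _ _ _ _ _ (fun k s' => exists2 l',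
   gj_inv (mx_of s 0 n.+1 d) (mx_of s' 0 n.+1 d) k l' & marked s' l')) => //.
  + by move=> s1 /agree_has_dims H; case: (H n.+1 d).
  + exists [::]; first exact: gj_inv0.
    by move=> i; rewrite m0.
  + move=> k s1 klt ag [l inv ml] ck.
    have dims1 : has_dims n.+1 d s1 by apply: agree_has_dims ag dims.
    apply: (runs_weaken (runs_pivot_col (j := Ordinal klt) dims1 ck ml) (leqnn _)).
    move=> s2 _ [p [pmax mp E]]; exists (rcons l p) => //.
    by rewrite E; apply: (gj_inv_step (j := Ordinal klt)).
- by [].
move=> s1 _ [l' inv ml'] ag1.
have dims1 : has_dims n.+1 d s1 by apply: agree_has_dims ag1 dims.
have G1 i j : rmem s1 3 i j = 0 by rewrite (proj2 ag1).
set W := mx_of s1 0 n.+1 d in inv.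
apply/runs_seq/(runs_weaken (runs_gram dims1 G1)) => // s2 _ G2 ag2.
have dims2 : has_dims n.+1 d s2 by apply: agree_has_dims ag2 dims1.
apply: (@runs_weaken _ _ _ (2 + n.+1 * (select_row_time n.+1 + 2)) _
  (fun s' => exists2 l, marked s' (l' ++ l) &
     selection_inv W n.+1 (mx_of s' 3 n.+1 n.+1) l)) => //; last first.
  by move=> s3 _ [l ml sel]; exists W, (mx_of s3 3 n.+1 n.+1), l, l'.
apply: (@runs_for _ _ _ _ _ _ _ (fun k s' => exists2 l, marked s' (l' ++ l) &
     selection_inv W k (mx_of s' 3 n.+1 n.+1) l)) => //.
- by move=> s3 /agree_has_dims H; case: (H n.+1 d).
- exists [::]; last by rewrite G2; apply: selection_inv0.
  by rewrite cats0 => i; rewrite (proj1 ag2).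
- move=> k s3 klt ag [l ml sel] ck.
  have dims3 : has_dims n.+1 d s3 by apply: agree_has_dims ag dims2.
  exact: (runs_select_row (k := Ordinal klt) dims3 ck ml sel).
Qed.

Lemma spanner_prog_correct (R : realType) (d : nat) (V : seq 'cV[R]_d) :
  (0 < d)%N -> uniq V ->
  exists (t : nat) (s : state R),
    [/\ exec spanner_prog (input V) t s,
        (t <= spanner_prog_time (size V) d)%N,
        spectral_spanner (soft_linear 6 1 d) [fset v in V] (output V s) &
        (#|` output V s|)%:R <= soft_linear 6 1 d :> R].
Proof.
move=> d0 uV.
have lnd : 0 <= ln d%:R :> R by apply: ln_ge0; rewrite ler1n.
have slE : soft_linear 6 1 d = 6 * d%:R * (1 + ln d%:R) :> R.
  by rewrite /soft_linear powRr1 // addr_ge0.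
case En: (size V) => [|n].
  (* Without vectors there is no row to pivot on; the program stops after two steps, the guard and
     [CSkip]. *)
  exists 2%N, (input V); have V0 := size0nil En.
  have U0 s : output V s = fset0.
    by apply/fsetP => v; rewrite V0 !inE.
  split.
  - by apply: ExecIfTrue; [rewrite /= /upd /= En | constructor].
  - by [].
  - by split=> [|v]; rewrite ?U0 ?fsub0set // V0 !inE.
  - rewrite U0 cardfs0 slE mulr_ge0 //; first by rewrite mulr_ge0 // ler0n.
    by rewrite addr_ge0.
have dims : has_dims n.+1 d (input V) by split=> //=; rewrite /upd /= En.
have [//|//|t [s [ex tT [W [G [l [l' [gj sel ms]]]]]]]] := runs_spanner_prog dims.
exists t, s.
have sizeV (i : 'I_n.+1) : (i < size V)%N by rewrite En.
pose lv := [seq nth 0 V (i : 'I_n.+1) | i <- l' ++ l].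
(* As [V] has no repetitions, [index] inverts [nth], so marks on positions correspond to vectors. *)
have outE v : (v \in output V s) = (v \in lv).
  rewrite !inE; apply/andP/mapP => [[vV mv]|[i il ->]].
    have iv : (index v V < n.+1)%N by rewrite -En index_mem.
    by exists (Ordinal iv); rewrite ?nth_index // -ms.
  by rewrite mem_nth // index_uniq // ms.
have size_l : size l' = d by case: gj.
(* The length of the list is d + k; bounding it yields both the factor [alpha] and the size of the
   output. *)
have size_lv : (size lv)%:R <= soft_linear 6 1 d :> R.
  rewrite size_map size_cat size_l slE; apply: arith_log_bound => //.
  exact: selection_size gj sel.
split=> //.
- apply: (@spanner_of_cover _ _ _ _ _ lv) => //.
  + by apply/fsubsetP => v; rewrite !inE => /andP[].
  + by move=> v; rewrite outE.
  + by rewrite size_map size_cat size_l addn_gt0 d0.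
  move=> v x; rewrite !inE => vV.
  have mulVx (i : 'I_n.+1) :
      (mx_of (input V) 0 n.+1 d *m x) i 0 = ((nth 0 V i)^T *m x) 0 0.
    by rewrite !mxE; apply: eq_bigr => p _; rewrite !mxE /= valK.
  have iv : (index v V < n.+1)%N by rewrite -En index_mem.
  have := spanner_cover x (Ordinal iv) gj sel.
  rewrite mulVx /= nth_index // => /le_trans; apply.
  by rewrite big_map; apply: ler_sum => i _; rewrite mulVx.
- apply: le_trans size_lv; rewrite ler_nat.
  by apply: uniq_leq_size => [|v]; rewrite ?fset_uniq // outE.
Qed.

Theorem theorem1p1 (R : realType) :
  (exists (prog : cmd) (K : nat) (C c : R),
    [/\ 0 < C, 0 < c &
      forall (d : nat) (V : seq 'cV[R]_d), (0 < d)%N -> uniq V ->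
        exists (t : nat) (s : state R),
          [/\ exec prog (input V) t s,
              (t <= K * (d + size V) ^ K)%N,
              spectral_spanner (soft_linear C c d) [fset v in V] (output V s) &
              (#|` output V s|)%:R <= soft_linear C c d]])
  /\
  (exists (C c : R),
    [/\ 0 < C, 0 < c &
      forall (d : nat) (V : {fset 'cV[R]_d}), (0 < d)%N ->
        exists U : {fset 'cV[R]_d},
          [/\ U `<=` V,
              (#|` U|)%:R <= soft_linear C c d &
              forall v : 'cV[R]_d, v \in V ->
                exists2 mu : U -> R, is_distribution mu &
                  loewner_le (v *m v^T) (soft_linear C c d *: second_moment mu)]]).
Proof.
split.
  (* The constants 6 and 1 are those of [arith_log_bound]. *)
  exists spanner_prog, 100%N, 6, 1; split=> // d V d0 uV.
  have [t [s [ex tT sp Usize]]] := spanner_prog_correct d0 uV.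
  exists t, s; split; [exact: ex | | exact: sp | exact: Usize].
  exact: leq_trans tT (spanner_prog_time_poly _ d0).
exists 6, 1; split=> // d V d0.
(* Existence follows by running the program on the enumeration of [V]. *)
have [t [s [_ _ [UV cov] Usize]]] := spanner_prog_correct d0 (fset_uniq V).
exists (output V s); split=> [||v vV]; last by apply: cov; rewrite !inE.
  by apply/fsubsetP => v /(fsubsetP UV); rewrite !inE.
exact: Usize.
Qed.
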